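(* Suppose that $\delta=1$. Let $\widetilde{v}$ denote the projection of a vertex $v$ of $\mathcal{T}$ in $GL_2(\mathcal{C})\backslash\mathcal{T}$. Then $$\mathrm{val}(\widetilde{v})=1,\;2,\;3\ \text{ or }\ \mathrm{card}(k)+1.$$
   Context: Setting: $k$ is a field and $K$ is an algebraic function field of one variable with constant field $k$, where $k$ is algebraically closed in $K$. $\infty$ is a fixed place of $K$ of degree $\delta$, $\mathcal{C}$ is the ring of all elements of $K$ that are integral outside $\infty$ (a Dedekind domain with unit group $k^*$), and $G=GL_2(\mathcal{C})$. $K_\infty$ is the completion of $K$ at $\infty$, $\mathcal{O}_\infty$ its valuation ring, $\pi\in K$ a local parameter at $\infty$, $k_\infty$ the residue field (of degree $\delta$ over $k$). $\mathcal{T}$ is the Bruhat-Tits tree of $GL_2(K_\infty)$: its vertices are the left cosets of $Z_\infty GL_2(\mathcal{O}_\infty)$ in $GL_2(K_\infty)$, where $Z_\infty$ is the group of scalar matrices in $GL_2(K_\infty)$ (equivalently, homothety classes of rank $2$ $\mathcal{O}_\infty$-lattices in $K_\infty^2$); the vertices given by $g_1,g_2$ are adjacent iff $g_2^{-1}g_1$ lies in the same left coset of $Z_\infty GL_2(\mathcal{O}_\infty)$ as $\begin{pmatrix}\pi & z\\0&1\end{pmatrix}$, for some $z$ in a set of representatives of $k_\infty$, or as $\begin{pmatrix}\pi^{-1}&0\\0&1\end{pmatrix}$. $G$ acts on $\mathcal{T}$ by left multiplication, without inversion. The valency $\mathrm{val}(\widetilde v)$ is the (cardinal) number of edges attached to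 $\widetilde v$ in the quotient graph $G\backslash\mathcal{T}$; equivalently, it is the cardinality of the set of $G_v$-orbits on the set of edges of $\mathcal{T}$ incident with $v$, where $G_v$ is the stabilizer of $v$ in $G$. *)

(* Defs.v *)
From HB Require Import structures.
From mathcomp Require Import all_boot all_order all_algebra.
From mathcomp Require Import mathcomp_extra boolp classical_sets functions
  cardinality.

Set Implicit Arguments.
Unset Strict Implicit.
Unset Printing Implicit Defensive.

Import Order.TTheory GRing.Theory Num.Theory.

Local Open Scope classical_set_scope.
Local Open Scope ring_scope.

(* A field extension K / k is given by a ring morphism iota : k -> K;
   subrings of K are sets of elements of K. *)

(* k(x), as a subset of K. *)
Definition ratfun_of (k K : fieldType) (iota : {rmorphism k -> K}) (x : K) :
    set K :=
  [set y | exists p q : {poly k}, (map_poly iota q).[x] != 0 /\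
             y = (map_poly iota p).[x] / (map_poly iota q).[x]].

(* K is a finite extension of k(x) for some x transcendental over k. *)
Definition function_field (k K : fieldType) (iota : {rmorphism k -> K}) :
    Prop :=
  exists x : K, ~ algebraicOver iota x /\
    exists (n : nat) (e : 'I_n -> K), forall y : K,
      exists c : 'I_n -> K,
        (forall i, ratfun_of iota x (c i)) /\ y = \sum_i c i * e i.

Definition algebraically_closed_in (k K : fieldType)
    (iota : {rmorphism k -> K}) : Prop :=
  forall a : K, algebraicOver iota a -> exists c : k, a = iota c.

(* A place of K / k is represented by its valuation ring: a proper subring O
   of K containing k such that x or x^-1 lies in O for every x. *)
Definition place (k K : fieldType) (iota : {rmorphism k -> K}) (O : set K) :
    Prop :=
  [/\ forall c : k, O (iota c),
      forall x y, O x -> O y -> O (x - y),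
      forall x y, O x -> O y -> O (x * y),
      O <> [set: K] &
      forall x, O x \/ O x^-1].

(* The maximal ideal of a valuation ring O; 0 is listed apart because
   0^-1 = 0. *)
Definition max_ideal (K : fieldType) (O : set K) : set K :=
  [set x | O x /\ (x = 0 \/ ~ O x^-1)].

(* The residue field of O has a k-basis with d elements, namely the classes of
   the b i. *)
Definition place_degree (k K : fieldType) (iota : {rmorphism k -> K})
    (O : set K) (d : nat) : Prop :=
  exists b : 'I_d -> K, (forall i, O (b i)) /\
    forall x, O x ->
      exists! c : {ffun 'I_d -> k},
        max_ideal O (x - \sum_i iota (c i) * b i).

Definition local_parameter (K : fieldType) (O : set K) (p : K) : Prop :=
  max_ideal O = [set p * x | x in O].

(* The elements of K that are integral at every place other than O. *)
Definition integral_outside (k K : fieldType) (iota : {rmorphism k -> K})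
    (O : set K) : set K :=
  [set x | forall O' : set K, place iota O' -> O' <> O -> O' x].

(* Normalized discrete valuations; the value w 0 is irrelevant. *)
Definition discrete_valuation (F : fieldType) (w : F -> int) : Prop :=
  [/\ forall x y : F, x != 0 -> y != 0 -> w (x * y) = w x + w y,
      forall x y : F, x != 0 -> y != 0 -> x + y != 0 ->
        Num.min (w x) (w y) <= w (x + y) &
      exists x : F, x != 0 /\ w x = 1].

(* The x with w x >= n, where w 0 is read as +oo; the valuation ring of w is
   val_ge w 0 and its maximal ideal is val_ge w 1. *)
Definition val_ge (F : fieldType) (w : F -> int) (n : int) : set F :=
  [set x | x = 0 \/ n <= w x].

Definition complete_for (F : fieldType) (w : F -> int) : Prop :=
  forall u : nat -> F,
    (forall n : int, exists N : nat, forall l m : nat,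
       (N <= l)%N -> (N <= m)%N -> val_ge w n (u l - u m)) ->
    exists y : F, forall n : int, exists N : nat, forall m : nat,
      (N <= m)%N -> val_ge w n (u m - y).

(* j : K -> F exhibits (F, w) as the completion of K at the place with
   valuation ring O. *)
Definition is_completion (K F : fieldType) (O : set K)
    (j : {rmorphism K -> F}) (w : F -> int) : Prop :=
  [/\ discrete_valuation w,
      forall x, O x <-> val_ge w 0 (j x),
      forall (y : F) (n : int), exists x : K, val_ge w n (y - j x) &
      complete_for w].

(* R contains exactly one element of each class of the residue field of w. *)
Definition residue_representatives (F : fieldType) (w : F -> int)
    (R : set F) : Prop :=
  R `<=` val_ge w 0 /\
  forall x, val_ge w 0 x -> exists! z, R z /\ val_ge w 1 (x - z).

(* GL_2 of a subring A of F. *)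
Definition GL2 (F : fieldType) (A : set F) : set 'M[F]_2 :=
  [set g | [/\ g \in unitmx, forall i j, A (g i j) &
               forall i j, A (invmx g i j)]].

Definition mat2 (F : fieldType) (a b c d : F) : 'M[F]_2 :=
  \matrix_(i, j) if i == 0 then (if j == 0 then a else b)
                 else (if j == 0 then c else d).

Definition scalar_GL2 (F : fieldType) (w : F -> int) : set 'M[F]_2 :=
  [set x | exists (a : F) (h : 'M[F]_2),
             [/\ a != 0, GL2 (val_ge w 0) h & x = a%:M *m h]].

(* The vertex of the tree given by g. *)
Definition coset_vertex (F : fieldType) (w : F -> int) (g : 'M[F]_2) :
    set 'M[F]_2 :=
  [set g *m h | h in scalar_GL2 w].

Definition tree_vertices (F : fieldType) (w : F -> int) :
    set (set 'M[F]_2) :=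
  [set v | exists2 g : 'M[F]_2, g \in unitmx & v = coset_vertex w g].

Definition tree_adjacent (F : fieldType) (w : F -> int) (p : F) (R : set F)
    (v1 v2 : set 'M[F]_2) : Prop :=
  exists g1 g2 : 'M[F]_2,
    [/\ g1 \in unitmx, g2 \in unitmx,
        v1 = coset_vertex w g1, v2 = coset_vertex w g2 &
        (exists2 z, R z &
           coset_vertex w (invmx g2 *m g1) = coset_vertex w (mat2 p z 0 1)) \/
        coset_vertex w (invmx g2 *m g1) = coset_vertex w (mat2 p^-1 0 0 1)].

(* The edges are the unordered pairs of adjacent vertices. *)
Definition tree_edges (F : fieldType) (w : F -> int) (p : F) (R : set F) :
    set (set (set 'M[F]_2)) :=
  [set e | exists v1 v2, tree_adjacent w p R v1 v2 /\ e = [set v1; v2]].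

Definition left_mul (K F : fieldType) (j : {rmorphism K -> F})
    (g : 'M[K]_2) (v : set 'M[F]_2) : set 'M[F]_2 :=
  [set map_mx j g *m x | x in v].

(* Quotient of a graph with vertices in T and edge set E, each edge being the
   set of its ends, by a group G acting through act. *)

Definition vertex_orbit (S T : Type) (G : set S) (act : S -> T -> T) (v : T) :
    set T :=
  [set act g v | g in G].

Definition edge_orbit (S T : Type) (G : set S) (act : S -> T -> T)
    (e : set T) : set (set T) :=
  [set act g @` e | g in G].

Definition quotient_edges (S T : Type) (G : set S) (act : S -> T -> T)
    (E : set (set T)) : set (set (set T)) :=
  [set edge_orbit G act e | e in E].

(* The ends of a quotient edge q are the orbits of the ends of the edges
   in q. *)
Definition quotient_ends (S T : Type) (G : set S) (act : S -> T -> T)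
    (q : set (set T)) : set (set T) :=
  [set vt | exists e v, [/\ q e, e v & vt = vertex_orbit G act v]].

(* The edges of the quotient graph attached to its vertex vt; the cardinal of
   this set is the valency of vt when the quotient has no loops, which is the
   case for GL_2(C) acting on the tree, since that action preserves the parity
   of the valuation of the determinant. *)
Definition edges_at (S T : Type) (G : set S) (act : S -> T -> T)
    (E : set (set T)) (vt : set T) : set (set (set T)) :=
  [set q | quotient_edges G act E q /\ quotient_ends G act q vt].

(* Main.v *)
Require Import Defs.
From HB Require Import structures.
From mathcomp Require Import all_boot all_order all_algebra.
From mathcomp Require Import mathcomp_extra boolp classical_sets functions
  cardinality.
From mathcomp Require Import ring zify.

Set Implicit Arguments.
Unset Strict Implicit.
Unset Printing Implicit Defensive.

Import Order.TTheory GRing.Theory Num.Theory.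

Local Open Scope classical_set_scope.
Local Open Scope card_scope.
Local Open Scope ring_scope.

(** The stabiliser of the vertex v = [g] acts on the edges at v through the
    reduction of g^-1 G_v g modulo the maximal ideal, that is, by a set of
    matrices over k acting on the projective line of k, since the residue field
    is k itself when the degree is 1.  This set is controlled by linear algebra.

    Let B be the set of reductions of the matrices with entries in C that
    preserve the lattice of g.  It is a k-subspace of the two by two matrices
    that contains the identity.  An integral matrix that lifts an element b of B
    has a determinant without poles; functions without poles are constants
    ([constant_of_integral], through the existence of enough places,
    [place_avoiding]), so this determinant is the constant det b.  Hence the
    invertible elements of B are exactly the reductions of the stabiliser of v:
    an element of G has a constant determinant, so when it fixes the vertex it
    even fixes the lattice.

    It remains to count the classes of the lines of k^2 under the relation that
    some invertible b in B maps the one to the other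
    ([card_linked_classes]).  A line fixed by B is alone in its class.  All
    other lines are in one class: two lines moved by the same a in B are linked
    by an invertible element x + y a of the pencil of a, whose determinant is
    computed by [det_pencil].  If B does not fix all lines, some a in B moves a
    line and then fixes at most two ([at_most_two_fixed]), whence 1, 2 or 3
    classes; if B fixes all lines, the classes are the card(k) + 1 lines.

    On the side of the tree, adjacency is membership of g2^-1 g1 in the double
    coset of diag(pi, 1), the neighbours of [g] are the [g m_t] for t a line
    ([adjacency_neighbourP], [fitsP]), and an integral invertible h sends the
    neighbour t to the neighbour s iff its reduction sends the line t to the
    line s ([neighbour_moved]).  The edges of the quotient attached to the image
    of v are the classes of the edges at v under the stabiliser of v, because no
    element of G maps v to a neighbour ([adjacent_not_equivalent]). *)

(** * Subrings, and places avoiding a transcendental element *)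

Definition subring (F : fieldType) (A : set F) : Prop :=
  [/\ A 1, forall x y, A x -> A y -> A (x - y) &
      forall x y, A x -> A y -> A (x * y)].

Section SubringTheory.
Variables (F : fieldType) (A : set F) (hA : subring A).

Lemma subring1 : A 1. Proof. by case: hA. Qed.

Lemma subringB x y : A x -> A y -> A (x - y).
Proof. by case: hA => _ hB _; apply: hB. Qed.

Lemma subringM x y : A x -> A y -> A (x * y).
Proof. by case: hA => _ _; apply. Qed.

Lemma subring0 : A 0.
Proof. by rewrite -(subrr 1); apply: subringB; apply: subring1. Qed.

Lemma subringN x : A x -> A (- x).
Proof. by rewrite -sub0r; apply: subringB; apply: subring0. Qed.

Lemma subringD x y : A x -> A y -> A (x + y).
Proof. by move=> Ax /subringN Ay; rewrite -(opprK y); apply: subringB. Qed.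

Lemma subring_sum (I : Type) (r : seq I) (P : pred I) (f : I -> F) :
  (forall i, P i -> A (f i)) -> A (\sum_(i <- r | P i) f i).
Proof.
by move=> Af; apply: big_ind Af; [apply: subring0 | apply: subringD].
Qed.

Definition adjoin (z : F) : set F :=
  [set q.[z] | q in [set q : {poly F} | forall i, A q`_i]].

Lemma subset_adjoin z : A `<=` adjoin z.
Proof.
move=> a Aa; exists a%:P; last by rewrite hornerC.
by move=> i; rewrite coefC; case: ifP => // _; apply: subring0.
Qed.

Lemma mem_adjoin z : adjoin z z.
Proof.
exists 'X; last by rewrite hornerX.
by move=> i; rewrite coefX; case: (i == 1)%N; [apply: subring1 | apply: subring0].
Qed.

Lemma subring_adjoin z : subring (adjoin z).
Proof.
split; first exact/subset_adjoin/subring1.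
- move=> _ _ [q Aq <-] [r Ar <-]; exists (q - r); last by rewrite !hornerE.
  by move=> i; rewrite coefB; apply: subringB.
- move=> _ _ [q Aq <-] [r Ar <-]; exists (q * r); last by rewrite hornerM.
  by move=> i; rewrite coefM; apply: subring_sum => l _; apply: subringM.
Qed.

End SubringTheory.

Section MaximalAvoiding.
Variables (F : fieldType) (y : F) (O : set F).
Hypothesis y0 : y != 0.
Hypotheses (hO : subring O) (Oy : O y) (Oy' : ~ O y^-1).
Hypothesis maxO : forall A, subring A -> O `<=` A -> ~ A y^-1 -> A `<=` O.

(** Inverting 1 + y * b does not create y^-1: since y^-1 (1 + y b)^(n+1) is
    y^-1 (1 + y b)^n + b (1 + y b)^n, membership in O descends to n = 0.  So
    the localisation still avoids y^-1, and maximality puts it inside O. *)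
Lemma unit_1Dmul b : O b -> O (1 + y * b)^-1.
Proof.
move=> Ob; have Ou : O (1 + y * b).
  by apply: subringD => //; [apply: subring1 | apply: subringM].
have u0 : 1 + y * b != 0.
  apply/eqP => u0; apply: Oy'.
  suff -> : y^-1 = - b by apply: subringN.
  by apply: (mulfI y0); rewrite mulfV // mulrN; apply/eqP; rewrite -subr_eq0 opprK u0.
pose A := [set a | exists n, O (a * (1 + y * b) ^+ n)].
have OX n : O ((1 + y * b) ^+ n).
  by elim: n => [|n IH]; [apply: subring1 | rewrite exprS; apply: subringM].
have hA : subring A.
  split; first by exists 0%N; rewrite mulr1; apply: subring1.
  - move=> a c [n An] [m Am]; exists (n + m)%N; rewrite mulrBl.
    rewrite {1}exprD mulrA [in X in _ - X]addnC exprD mulrA.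
    by apply: subringB => //; apply: subringM.
  - move=> a c [n An] [m Am]; exists (n + m)%N.
    by rewrite exprD mulrACA; apply: subringM.
have OA : O `<=` A by move=> a Oa; exists 0%N; rewrite mulr1.
apply: (maxO hA OA); last by exists 1%N; rewrite mulVf //; apply: subring1.
move=> [n]; elim: n => [|n IH]; first by rewrite mulr1.
rewrite exprS mulrA mulrDr mulr1 mulrA mulVf // mul1r mulrDl => H.
apply: IH; rewrite -[X in O X](addrK (b * (1 + y * b) ^+ n)).
by apply: subringB => //; apply: subringM.
Qed.

(** Two relations expressing 1 as a polynomial in z, resp. z^-1, with
    coefficients in the ideal y O cannot coexist.  After exchanging z and z^-1
    the relation for z has the larger degree; its leading monomial can then be
    lowered with the other relation, whose constant term r_0 satisfies
    1 - r_0 in 1 + y O, hence is a unit.  The induction is on a bound N of the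
    sum of the degrees. *)
Lemma no_two_relations N z n m (q r : {poly F}) : (n + m <= N)%N -> z != 0 ->
  (size q <= n.+1)%N -> (size r <= m.+1)%N ->
  (forall i, O (q`_i / y)) -> (forall i, O (r`_i / y)) ->
  q.[z] = 1 -> r.[z^-1] = 1 -> False.
Proof.
elim: N z n m q r => [|N IH] z n m q r.
all: wlog le_mn : z n m q r / (m <= n)%N.
- move=> H hN z0 sq sr Oq Or qz rz; have [le|/ltnW le] := leqP m n.
    exact: (H z n m q r).
  by apply: (H z^-1 m n r q) => //; rewrite ?invr_eq0 ?invrK // addnC.
- rewrite leqn0 addn_eq0 => /andP[/eqP-> _] _ /size1_polyC -> _ Oq _.
  rewrite hornerC => q0 _; apply: Oy'.
  by have := Oq 0; rewrite coefC q0 div1r.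
- move=> H hN z0 sq sr Oq Or qz rz; have [le|/ltnW le] := leqP m n.
    exact: (H z n m q r).
  by apply: (H z^-1 m n r q) => //; rewrite ?invr_eq0 ?invrK // addnC.
case: n le_mn => [|n] le_mn hN z0 sq sr Oq Or qz rz.
  move: sq => /size1_polyC eq_q; apply: Oy'.
  by have := Oq 0; rewrite eq_q coefC -{1}(hornerC q`_0 z) -eq_q qz div1r.
(* The relation for z^-1 expresses z ^+ n.+1 through lower powers of z. *)
have u0 : 1 - r`_0 != 0.
  rewrite subr_eq0; apply/eqP => r0; apply: Oy'.
  by have := Or 0; rewrite -r0 div1r.
have Ou : O (1 - r`_0)^-1.
  have -> : 1 - r`_0 = 1 + y * - (r`_0 / y) by field.
  by apply: unit_1Dmul; apply: subringN.
pose q' := \poly_(i < n.+1) (q`_i + q`_n.+1 / (1 - r`_0) * r`_(n.+1 - i)).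
apply: (IH z n m q' r) => //.
- exact: size_poly.
- move=> i; rewrite coef_poly; case: ifP => _; last by rewrite mul0r; apply: subring0.
  rewrite mulrDl; apply: subringD => //; rewrite -mulrA -mulrA.
  have -> : q`_n.+1 * ((1 - r`_0)^-1 * (r`_(n.+1 - i) / y)) =
    q`_n.+1 / y * y * ((1 - r`_0)^-1 * (r`_(n.+1 - i) / y)) by rewrite divfK.
  by do !apply: subringM => //.
have low : \sum_(i < n.+1) r`_(n.+1 - i) * z ^+ i = (1 - r`_0) * z ^+ n.+1.
  rewrite -rz (@horner_coef_wide _ n.+2) ?(leq_trans sr) //.
  rewrite [in RHS]big_ord_recl /=.
  rewrite expr0 mulr1 [r`_0 + _]addrC addrK mulr_suml (reindex_inj rev_ord_inj) /=.
  apply: eq_bigr => i _; rewrite subKn // -mulrA exprVn; congr (_ * _).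
  by rewrite mulrC -exprB ?unitfE // ltn_ord.
rewrite -qz (@horner_coef_wide _ n.+1) ?size_poly //.
rewrite (@horner_coef_wide _ n.+2) // [RHS]big_ord_recr /=.
under eq_bigr => i _ do rewrite coef_poly ltn_ord mulrDl -mulrA.
rewrite big_split /= -mulr_sumr low; congr (_ + _).
by rewrite -!mulrA mulKf.
Qed.

(** If neither z nor z^-1 were in O, then by maximality y^-1 would lie both in
    O[z] and in O[z^-1]; multiplying by y gives two incompatible relations. *)
Lemma maximal_avoiding_valuation z : O z \/ O z^-1.
Proof.
have [->|z0] := eqVneq z 0; first by left; apply: subring0.
apply: contrapT => /not_orP[Nz Nz'].
have rel t : ~ O t -> exists2 q : {poly F}, forall i, O (q`_i / y) & q.[t] = 1.
  move=> Nt; have : adjoin O t y^-1.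
    apply: contrapT => H; apply: Nt.
    apply: (maxO (subring_adjoin hO t)) => //; last exact: mem_adjoin.
    exact: subset_adjoin.
  case=> q Oq qt; exists (y *: q); last by rewrite hornerZ qt mulfV.
  by move=> i; rewrite coefZ mulrC mulKf.
have [q Oq qz] := rel _ Nz; have [r Or rz] := rel _ Nz'.
by apply: (@no_two_relations _ z (size q) (size r) q r (leqnn _)).
Qed.

End MaximalAvoiding.

(** Chevalley's extension argument: k[x^-1] does not contain x, because
    x = q(x^-1) would make x algebraic, and a subring maximal among those that
    contain k[x^-1] and avoid x is a valuation ring. *)
Lemma place_avoiding (k K : fieldType) (iota : {rmorphism k -> K}) (x : K) :
  ~ algebraicOver iota x -> exists2 O : set K, place iota O & ~ O x.
Proof.
move=> Nx; pose y := x^-1.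
have x0 : x != 0.
  by apply/eqP => x0; apply: Nx; rewrite x0; apply: algebraic0.
have y0 : y != 0 by rewrite invr_eq0.
pose good A := [/\ subring A, forall c, A (iota c), A y & ~ A x].
pose A0 := [set (map_poly iota q).[y] | q in setT].
have good0 : good A0.
  split.
  - split; first by exists 1 => //; rewrite rmorph1 hornerC.
    + by move=> _ _ [q _ <-] [r _ <-]; exists (q - r) => //; rewrite rmorphB !hornerE.
    + by move=> _ _ [q _ <-] [r _ <-]; exists (q * r) => //; rewrite rmorphM hornerM.
  - by move=> c; exists c%:P => //; rewrite map_polyC hornerC.
  - by exists 'X => //; rewrite map_polyX hornerX.
  - case=> q _ qy; apply: Nx; rewrite -(invrK x); apply: algebraic_inv.
    exists (q * 'X - 1).
      apply/eqP => /(congr1 (fun s : {poly k} => s`_0)) /eqP.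
      by rewrite coefB coefMX coef1 coef0 sub0r oppr_eq0 oner_eq0.
    rewrite /root rmorphB rmorphM rmorph1 /= map_polyX !hornerE -/y.
    by rewrite qy mulfV // subrr.
have [t maxt] : exists t : {A : set K | good A}, forall s,
    `[< sval t `<=` sval s >] -> s = t.
  apply: (@Zorn _ (fun s t : {A : set K | good A} => `[< sval s `<=` sval t >])).
  - by move=> t; apply/asboolP.
  - by move=> r s t /asboolP rs /asboolP st; apply/asboolP; apply: subset_trans st.
  - move=> [A gA] [B gB] /asboolP /= AB /asboolP /= BA.
    by apply: eq_exist; apply/seteqP.
  - move=> C totC.
    have [[s0 Cs0]|C0] := pselect (exists s, C s); last first.
      by exists (exist _ _ good0) => s Cs; case: C0; exists s.
    pose U := [set a | exists2 s, C s & sval s a].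
    suff gU : good U.
      by exists (exist _ _ gU) => s Cs; apply/asboolP => a sa; exists s.
    have join a b : U a -> U b -> exists s, [/\ C s, sval s a & sval s b].
      move=> [s Cs sa] [t Ct tb]; case: (totC s t Cs Ct) => /asboolP st.
        by exists t; split => //; apply: st.
      by exists s; split => //; apply: st.
    split.
    + split; first by exists s0 => //; case: (svalP s0) => -[].
      * move=> a b Ua Ub; have [s [Cs sa sb]] := join _ _ Ua Ub.
        by exists s => //; case: (svalP s) => hs _ _ _; apply: (subringB hs).
      * move=> a b Ua Ub; have [s [Cs sa sb]] := join _ _ Ua Ub.
        by exists s => //; case: (svalP s) => hs _ _ _; apply: (subringM hs).
    + by move=> c; exists s0 => //; case: (svalP s0).
    + by exists s0 => //; case: (svalP s0).
    + by move=> [s _ sx]; case: (svalP s).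
case: t maxt => O [hO Ok Oy Ox] /= maxO; exists O => //.
have yx : y^-1 = x by rewrite invrK.
split => //; [exact: subringB | exact: subringM | |].
  by move=> OT; apply: (Ox); rewrite OT.
apply: (@maximal_avoiding_valuation _ y) => //; rewrite yx // => A hA OA NA.
have gA : good A by split => // [c|]; apply: OA.
have := maxO (exist _ A gA); rewrite asboolT // => /(_ isT) [->] //.
Qed.

(** The only functions without poles are the constants: a place that avoids x
    exists as soon as x is not algebraic over k. *)
Lemma constant_of_integral (k K : fieldType) (iota : {rmorphism k -> K})
    (O : set K) : algebraically_closed_in iota ->
  forall x, integral_outside iota O x -> O x -> exists c, x = iota c.
Proof.
move=> hk x Cx Ox; apply: hk; apply: contrapT => /place_avoiding[O' pO' NO'x].
by apply: (NO'x); apply: Cx => // eO; apply: NO'x; rewrite eO.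
Qed.

Lemma subring_place (k K : fieldType) (iota : {rmorphism k -> K}) (O : set K) :
  place iota O -> subring O.
Proof. by case=> Ok OB OM _ _; split => //; rewrite -(rmorph1 iota). Qed.

Lemma subring_integral_outside (k K : fieldType) (iota : {rmorphism k -> K})
  (O : set K) : subring (integral_outside iota O).
Proof.
split=> [O' pO' _|x y Cx Cy O' pO' NO'|x y Cx Cy O' pO' NO'].
- exact: (subring1 (subring_place pO')).
- by apply: (subringB (subring_place pO')); [apply: Cx | apply: Cy].
- by apply: (subringM (subring_place pO')); [apply: Cx | apply: Cy].
Qed.

Lemma integral_outside_constant (k K : fieldType) (iota : {rmorphism k -> K})
  (O : set K) c : integral_outside iota O (iota c).
Proof. by move=> O' [Ok]. Qed.

Lemma constant_unit (k K : fieldType) (iota : {rmorphism k -> K})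
    (O : set K) : algebraically_closed_in iota -> place iota O ->
  forall u, integral_outside iota O u -> integral_outside iota O u^-1 ->
  exists c, u = iota c.
Proof.
move=> hk [_ _ _ _ val] u Cu Cu'; have [Ou|Ou'] := val u.
  exact: constant_of_integral Ou.
have [c uc] := constant_of_integral hk Cu' Ou'.
by exists c^-1; rewrite fmorphV -uc invrK.
Qed.

(** * Orbits on the projective line of a linear space of matrices *)

Lemma card_set2_neq (T : Type) (x y : T) : x <> y -> [set x; y] #= `I_2.
Proof.
move=> xy; pose f (n : nat) := if n == 0%N then x else y.
have -> : [set x; y] = f @` `I_2.
  apply/seteqP; split=> [_ [->|->]|_ [n _ <-]]; [by exists 0%N|by exists 1%N|].
  by rewrite /f; case: ifP => _; [left|right].
by apply: inj_card_eq => -[|[|n]] [|[|m]]; rewrite !inE //= /f /= => _ _ // /esym.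
Qed.

Lemma card_set3_neq (T : Type) (x y z : T) : x <> y -> x <> z -> y <> z ->
  [set x; y; z] #= `I_3.
Proof.
move=> xy xz yz; pose f n := if n is n'.+1 then if n' is _.+1 then z else y else x.
have -> : [set x; y; z] = f @` `I_3.
  apply/seteqP; split=> [_ [[->|->]|->]|_ [n _ <-]].
  - by exists 0%N.
  - by exists 1%N.
  - by exists 2%N.
  - by case: n => [|[|n]] /=; [left; left|left; right|right].
apply: inj_card_eq => -[|[|[|n]]] [|[|[|m]]]; rewrite !inE //= => _ _ // /esym //.
Qed.

(** Homogeneous coordinates: Some z stands for the line spanned by (z, 1) and
    None for the line spanned by (1, 0). *)
Definition line_x (k : fieldType) (t : option k) : k := if t is Some z then z else 1.
Definition line_y (k : fieldType) (t : option k) : k := if t is Some z then 1 else 0.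

(** The determinant of the pair of vectors s and b t; it vanishes exactly when
    b maps the line t into the line s.  Being linear in b, it is easier to
    handle than the action itself. *)
Definition sends_form (k : fieldType) (b : 'M[k]_2) (t s : option k) : k :=
  line_x s * (b 1 0 * line_x t + b 1 1 * line_y t) -
  line_y s * (b 0 0 * line_x t + b 0 1 * line_y t).

Lemma det2 (R : comNzRingType) (a : 'M[R]_2) :
  \det a = a 0 0 * a 1 1 - a 0 1 * a 1 0.
Proof.
rewrite (expand_det_row _ 0) !big_ord_recl big_ord0 /cofactor !det_mx11 !mxE /=.
rewrite /bump /= !addn0 expr0 expr1 mul1r addr0 mulN1r mulrN.
by congr (a _ _ * a _ _ - a _ _ * a _ _); apply/val_inj.
Qed.

Section ProjectiveLine.
Variable k : fieldType.
Implicit Types (a b : 'M[k]_2) (t s : option k).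

Lemma sends_form1 t s : sends_form 1%:M t s = 0 -> t = s.
Proof.
rewrite /sends_form !mxE /=; case: t s => [z|] [z'|] //=.
- by rewrite !(mul1r, mulr1, mul0r, add0r, addr0) => /subr0_eq ->.
- by rewrite !(mul1r, mulr1, mul0r, add0r, subr0) => /eqP; rewrite oner_eq0.
- by rewrite !(mul1r, mulr0, mul0r, addr0, sub0r) => /eqP; rewrite oppr_eq0 oner_eq0.
Qed.

Lemma sends_form_lin x y a b t s :
  sends_form (x *: a + y *: b) t s = x * sends_form a t s + y * sends_form b t s.
Proof. by rewrite /sends_form !mxE; ring. Qed.

(** When a moves t, the vectors t and a t form a basis, and the matrix on the
    left, which is a polynomial in a, is the one that maps t to a multiple of s.
    Commuting with a, it maps a t to the same multiple of a s, so its
    determinant is read off by comparing the bases (t, a t) and (s, a s). *)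
Lemma det_pencil a t s :
  \det (sends_form a t s *: 1%:M - sends_form 1%:M t s *: a) =
  sends_form a t t * sends_form a s s.
Proof. by rewrite det2 /sends_form !mxE /=; ring. Qed.

(** If s and t were distinct, b t would lie on both lines, hence vanish. *)
Lemma fixed_sends b t s : \det b != 0 -> sends_form b t t = 0 ->
  sends_form b t s = 0 -> t = s.
Proof.
move=> b0 btt bts; apply: sends_form1; apply: contraNeq b0 => ts.
pose u := b 0 0 * line_x t + b 0 1 * line_y t.
pose u' := b 1 0 * line_x t + b 1 1 * line_y t.
have hu : u = 0.
  apply: (mulfI ts); transitivity (line_x t * sends_form b t s - line_x s * sends_form b t t).
    by rewrite /u /sends_form !mxE /=; ring.
  by rewrite btt bts !mulr0 subrr.
have hu' : u' = 0.
  apply: (mulfI ts); transitivity (line_y t * sends_form b t s - line_y s * sends_form b t t).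
    by rewrite /u' /sends_form !mxE /=; ring.
  by rewrite btt bts !mulr0 subrr.
apply/eqP; apply: (mulfI ts); rewrite mulr0 det2.
transitivity (u' * (line_x s * b 0 0 + line_y s * b 0 1)
              - u * (line_x s * b 1 0 + line_y s * b 1 1)).
  by rewrite /u /u' /sends_form !mxE /=; ring.
by rewrite hu hu'; ring.
Qed.

(** The form t |-> sends_form a t t is a binary quadratic form; Lagrange
    interpolation at three distinct points would make it vanish at t. *)
Lemma at_most_two_fixed a t t1 t2 t3 : sends_form a t t != 0 ->
  sends_form a t1 t1 = 0 -> sends_form a t2 t2 = 0 -> sends_form a t3 t3 = 0 ->
  [\/ t1 = t2, t1 = t3 | t2 = t3].
Proof.
move=> at0 a1 a2 a3; pose d u v : k := sends_form 1%:M u v.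
have : sends_form a t t * (d t1 t2 * d t1 t3 * d t2 t3) =
   sends_form a t1 t1 * (d t t2 * d t t3 * d t2 t3)
   - sends_form a t2 t2 * (d t t1 * d t t3 * d t1 t3)
   + sends_form a t3 t3 * (d t t1 * d t t2 * d t1 t2).
  by rewrite /d /sends_form !mxE /=; ring.
rewrite a1 a2 a3 !mul0r subrr addr0 => /eqP.
rewrite !mulf_eq0 (negPf at0) /= -orbA => /or3P[]/eqP/sends_form1 ->.
- by apply: Or31.
- by apply: Or32.
- by apply: Or33.
Qed.

Definition linked (B : set 'M[k]_2) t s :=
  exists b, [/\ B b, \det b != 0 & sends_form b t s = 0].

Variable B : set 'M[k]_2.
Hypothesis B1 : B 1%:M.
Hypothesis Blin : forall x y a b, B a -> B b -> B (x *: a + y *: b).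

(** A single matrix moving both lines links them through its pencil.  If a fixes
    s and a' fixes t, then a + a' moves both. *)
Lemma moved_linked t s a a' : B a -> B a' ->
  sends_form a t t != 0 -> sends_form a' s s != 0 -> linked B t s.
Proof.
have pencil c : B c -> sends_form c t t != 0 -> sends_form c s s != 0 -> linked B t s.
  move=> Bc ct cs.
  exists (sends_form c t s *: 1%:M - sends_form 1%:M t s *: c); split.
  - by rewrite -scaleNr; apply: Blin.
  - by rewrite det_pencil mulf_neq0.
  - by rewrite -scaleNr sends_form_lin mulNr mulrC subrr.
move=> Ba Ba' at0 a's.
have [as0|] := eqVneq (sends_form a s s) 0; last exact: pencil.
have [a't|] := eqVneq (sends_form a' t t) 0; last by move=> a't; apply: (pencil a').
apply: (pencil (1 *: a + 1 *: a')); first exact: Blin.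
  by rewrite sends_form_lin a't mulr0 addr0 mul1r.
by rewrite sends_form_lin as0 mulr0 add0r mul1r.
Qed.

(** A line fixed by all of B is a class by itself, and the other lines form at
    most one class.  Either every line is fixed and the classes are the points
    of the projective line, or some a in B moves a line t0; then at most two
    lines are fixed, and the class of t0 is the only other one. *)
Lemma card_linked_classes (T : Type) (q : option k -> T) :
  (forall t s, q t = q s <-> linked B t s) ->
  let Q := q @` setT in
  [\/ Q #= `I_1, Q #= `I_2, Q #= `I_3 | Q #= [set: option k]].
Proof.
move=> qP Q; pose fixed t := forall a, B a -> sends_form a t t = 0.
have fixed_eq t s : fixed t -> q t = q s -> t = s.
  by move=> ft /qP[b [Bb b0 bts]]; apply: fixed_sends bts => //; apply: ft.
have [allf|/existsNP[t0 Nt0]] := pselect (forall t, fixed t).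
  by apply: Or44; apply: inj_card_eq => t s _ _; apply: fixed_eq.
have [a0 /not_implyP[Ba0 /eqP a0t0]] : exists a, ~ (B a -> sends_form a t0 t0 = 0).
  exact/existsNP.
have moved t : ~ fixed t -> q t = q t0.
  move=> /existsNP[a /not_implyP[Ba /eqP at0]].
  by apply/qP; apply: (moved_linked Ba Ba0).
have neq0 t : fixed t -> q t <> q t0.
  by move=> ft /(fixed_eq _ _ ft) et; apply: Nt0; rewrite -et.
have [[s1 f1]|Nf] := pselect (exists s, fixed s); last first.
  apply: Or41; suff -> : Q = [set q t0] by apply: card_set1.
  apply/seteqP; split=> [_ [t _ <-]|_ ->]; last by exists t0.
  by apply: moved => ft; apply: Nf; exists t.
have [[s2 [f2 s21]]|Nf] := pselect (exists s, fixed s /\ s <> s1); last first.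
  apply: Or42; suff -> : Q = [set q s1; q t0].
    exact: card_set2_neq (neq0 _ f1).
  apply/seteqP; split=> [_ [t _ <-]|_ [->|->]]; [|by exists s1|by exists t0].
  have [ft|/moved] := pselect (fixed t); last by right.
  by left; congr q; apply: contrapT => ts; apply: Nf; exists t.
apply: Or43; suff -> : Q = [set q s1; q s2; q t0].
  apply: card_set3_neq; [|exact: neq0|exact: neq0].
  by move=> /(fixed_eq _ _ f1) /esym.
apply/seteqP; split=> [_ [t _ <-]|_ [[->|->]|->]];
  [|by exists s1|by exists s2|by exists t0].
have [ft|/moved] := pselect (fixed t); last by right.
left; have [] := at_most_two_fixed a0t0 (f1 _ Ba0) (f2 _ Ba0) (ft _ Ba0).
- by move=> e; case: s21.
- by move=> ->; left.
- by move=> ->; right.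
Qed.

End ProjectiveLine.

(** * Two by two matrices over a subring *)

Lemma ord2P (P : 'I_2 -> Prop) : P 0 -> P 1 -> forall i, P i.
Proof.
move=> P0 P1 [[|[|//]] lt_i2].
- by rewrite (_ : Ordinal _ = 0) //; apply: val_inj.
- by rewrite (_ : Ordinal _ = 1) //; apply: val_inj.
Qed.

Section Mat2.
Variable F : fieldType.
Implicit Types (g h m : 'M[F]_2) (A : set F).

Lemma mulmx2E g h i j : (g *m h) i j = g i 0 * h 0 j + g i 1 * h 1 j.
Proof.
rewrite mxE !big_ord_recl big_ord0 addr0.
by congr (_ + g i _ * h _ j); apply: val_inj.
Qed.

Lemma lin_mxE a c g h i j : (a *: g + c *: h) i j = a * g i j + c * h i j.
Proof. by rewrite !mxE. Qed.

Lemma mat2_eq g h : g 0 0 = h 0 0 -> g 0 1 = h 0 1 -> g 1 0 = h 1 0 ->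
  g 1 1 = h 1 1 -> g = h.
Proof. by move=> e1 e2 e3 e4; apply/matrixP; apply: ord2P; apply: ord2P. Qed.

Lemma adj2 g : \adj g = mat2 (g 1 1) (- g 0 1) (- g 1 0) (g 0 0).
Proof.
have adjE (i j i' j' : 'I_2) : lift i (ord0 : 'I_1) = i' ->
    lift j (ord0 : 'I_1) = j' ->
    \adj g j i = (-1) ^+ (i + j) * g i' j'.
  by move=> <- <-; rewrite mxE /cofactor det_mx11 !mxE.
have l0 : lift (0 : 'I_2) (ord0 : 'I_1) = 1 by apply: val_inj.
have l1 : lift (1 : 'I_2) (ord0 : 'I_1) = 0 by apply: val_inj.
apply: mat2_eq; rewrite [RHS]mxE /=.
- by rewrite (adjE _ _ _ _ l0 l0) expr0 mul1r.
- by rewrite (adjE _ _ _ _ l1 l0) expr1 mulN1r.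
- by rewrite (adjE _ _ _ _ l0 l1) expr1 mulN1r.
- by rewrite (adjE _ _ _ _ l1 l1) sqrrN expr1n mul1r.
Qed.

Lemma det_adj2 g : \det (\adj g) = \det g.
Proof. by rewrite adj2 !det2 !mxE /=; ring. Qed.

Lemma unitmx_det g : (g \in unitmx) = (\det g != 0).
Proof. by rewrite unitmxE unitfE. Qed.

Lemma det_subring A g : subring A -> (forall i j, A (g i j)) -> A (\det g).
Proof. by move=> hA Ag; rewrite det2; apply: subringB => //; apply: subringM. Qed.

Lemma adj_subring A g : subring A -> (forall i j, A (g i j)) ->
  forall i j, A ((\adj g) i j).
Proof.
move=> hA Ag; rewrite adj2.
by apply: ord2P; apply: ord2P; rewrite mxE /= ?Ag //; apply: subringN.
Qed.

Lemma mulmx_subring A g h : subring A -> (forall i j, A (g i j)) ->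
  (forall i j, A (h i j)) -> forall i j, A ((g *m h) i j).
Proof.
by move=> hA Ag Ah i j; rewrite mulmx2E; apply: subringD => //; apply: subringM.
Qed.

Lemma GL2P A g : subring A -> GL2 A g <->
  [/\ forall i j, A (g i j), \det g != 0 & A (\det g)^-1].
Proof.
move=> hA; split=> [[gU Ag Ag']|[Ag g0 Ag']].
  split=> //; first by rewrite -unitmx_det.
  by rewrite -det_inv; apply: det_subring.
have gU : g \in unitmx by rewrite unitmx_det.
split=> // i j; rewrite /invmx gU mxE.
by apply: subringM => //; apply: adj_subring.
Qed.

Lemma GL2_1 A : subring A -> GL2 A 1%:M.
Proof.
move=> hA; apply/GL2P => //; rewrite det1 invr1 oner_eq0.
split=> //; last exact: subring1.
by move=> i j; rewrite mxE; case: (i == j); [apply: subring1 | apply: subring0].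
Qed.

Lemma GL2_mul A g h : subring A -> GL2 A g -> GL2 A h -> GL2 A (g *m h).
Proof.
move=> hA /(GL2P _ hA)[Ag g0 Ag'] /(GL2P _ hA)[Ah h0 Ah']; apply/GL2P => //.
split; first exact: mulmx_subring.
  by rewrite det_mulmx mulf_neq0.
by rewrite det_mulmx invfM; apply: subringM.
Qed.

Lemma GL2_inv A g : GL2 A g -> GL2 A (invmx g).
Proof. by case=> gU Ag Ag'; split; rewrite ?unitmx_inv ?invmxK. Qed.

End Mat2.

(** * Discrete valuations *)

Section Valuation.
Variables (F : fieldType) (w : F -> int) (hw : discrete_valuation w).

Lemma valuationM x y : x != 0 -> y != 0 -> w (x * y) = w x + w y.
Proof. by case: hw => + _ _; apply. Qed.

Lemma valuation1 : w 1 = 0.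
Proof.
have := valuationM (oner_neq0 F) (oner_neq0 F); rewrite mulr1 => /esym/eqP.
by rewrite -subr_eq0 addrK => /eqP.
Qed.

Lemma valuationV x : x != 0 -> w x^-1 = - w x.
Proof.
move=> x0; have := valuationM x0 (invr_neq0 x0); rewrite mulfV // valuation1 => /esym/eqP.
by rewrite addr_eq0 => /eqP ->; rewrite opprK.
Qed.

Lemma valuationN x : x != 0 -> w (- x) = w x.
Proof.
have N1 : (-1 : F) != 0 by rewrite oppr_eq0 oner_eq0.
have wN1 : w (-1) = 0 by have := valuationM N1 N1; rewrite mulrNN mulr1 valuation1; lia.
by move=> x0; rewrite -mulN1r valuationM // wN1 add0r.
Qed.

Lemma val_geM n m x y : val_ge w n x -> val_ge w m y -> val_ge w (n + m) (x * y).
Proof.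
move=> [->|nx]; first by rewrite mul0r; left.
move=> [->|my]; first by rewrite mulr0; left.
have [->|x0] := eqVneq x 0; first by rewrite mul0r; left.
have [->|y0] := eqVneq y 0; first by rewrite mulr0; left.
by right; rewrite valuationM //; apply: lerD.
Qed.

Lemma val_geB n x y : val_ge w n x -> val_ge w n y -> val_ge w n (x - y).
Proof.
have [->|x0] := eqVneq x 0.
  have [->|y0] := eqVneq y 0; first by rewrite subrr; left.
  by move=> _ [/eqP|ny]; [rewrite (negPf y0) | rewrite sub0r; right; rewrite valuationN].
have [->|y0] := eqVneq y 0; first by rewrite subr0.
move=> [/eqP|nx]; first by rewrite (negPf x0).
move=> [/eqP|ny]; first by rewrite (negPf y0).
have [->|xy0] := eqVneq (x - y) 0; [by left|right].
have Ny0 : - y != 0 by rewrite oppr_eq0.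
case: hw => _ wD _; apply: le_trans (wD _ _ x0 Ny0 xy0).
by rewrite valuationN // le_min nx.
Qed.

Lemma val_ge0 n : val_ge w n 0. Proof. by left. Qed.

Lemma val_geN n x : val_ge w n x -> val_ge w n (- x).
Proof. by rewrite -sub0r; apply: val_geB; left. Qed.

Lemma val_geD n x y : val_ge w n x -> val_ge w n y -> val_ge w n (x + y).
Proof. by move=> nx /val_geN ny; rewrite -(opprK y); apply: val_geB. Qed.

Lemma val_geW n m x : m <= n -> val_ge w n x -> val_ge w m x.
Proof. by move=> le_mn [->|nx]; [left | right; apply: le_trans nx]. Qed.

Lemma subring_val_ge : subring (val_ge w 0).
Proof.
split; first by right; rewrite valuation1.
- by move=> x y; apply: val_geB.
- by move=> x y /val_geM H /H; rewrite addr0.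
Qed.

Lemma max_val_geM x y : val_ge w 0 x -> val_ge w 1 y -> val_ge w 1 (x * y).
Proof. by move=> /val_geM H /H; rewrite add0r. Qed.

Lemma val_ge1P x : x != 0 ->
  val_ge w 1 x <-> val_ge w 0 x /\ ~ val_ge w 0 x^-1.
Proof.
move=> x0; have Nx : x = 0 -> False by move/eqP; rewrite (negPf x0).
have Nx' : x^-1 = 0 -> False by move/eqP; rewrite invr_eq0 (negPf x0).
split=> [[/Nx[]|wx]|[[/Nx[]|wx] Nwx]].
  split; first by right; lia.
  by move=> [/Nx'[]|]; rewrite valuationV //; lia.
right; apply: contrapT => wx'; apply: Nwx; right.
by rewrite valuationV //; lia.
Qed.

(** The valuation is locally constant away from 0. *)
Lemma valuation_approx n x y : y != 0 -> w y = n -> val_ge w (n + 1) (y - x) ->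
  x != 0 /\ w x = n.
Proof.
move=> y0 wy yx; have Ny : ~ val_ge w (n + 1) y.
  by move=> [/eqP|]; rewrite ?(negPf y0) // wy; lia.
have [x0|] := eqVneq x 0; first by move: yx; rewrite x0 subr0 => /Ny.
move=> x0; split=> //; have : val_ge w n x.
  rewrite -(subKr y x); apply: val_geB; first by right; rewrite wy.
  by apply: val_geW yx; lia.
case=> [/eqP|wx]; first by rewrite (negPf x0).
apply: contrapT => wx'; apply: Ny; rewrite -(subrK x y); apply: val_geD => //.
by right; lia.
Qed.

Lemma GL2_valP h : GL2 (val_ge w 0) h <->
  [/\ forall i j, val_ge w 0 (h i j), \det h != 0 & w (\det h) = 0].
Proof.
have hO := subring_val_ge; split.
  move=> /(GL2P _ hO)[Oh h0 Oh']; split=> //.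
  have := det_subring hO Oh; move: Oh'.
  move=> [/eqP|]; first by rewrite invr_eq0 (negPf h0).
  rewrite valuationV // => wh' [/eqP|wh]; first by rewrite (negPf h0).
  by apply/eqP; rewrite eq_le wh -oppr_ge0 wh'.
move=> [Oh h0 wh]; apply/GL2P => //; split=> //.
by right; rewrite valuationV // wh oppr0.
Qed.

End Valuation.

(** * Vertices and the adjacency relation of the tree *)

Section Vertices.
Variables (F : fieldType) (w : F -> int) (hw : discrete_valuation w).
Let hO := subring_val_ge hw.
Implicit Types g h m : 'M[F]_2.

Lemma scalar_GL2P h : scalar_GL2 w h <->
  exists a h', [/\ a != 0, GL2 (val_ge w 0) h' & h = a *: h'].
Proof.
by split=> -[a [h' [a0 Gh' ->]]]; exists a, h'; rewrite mul_scalar_mx.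
Qed.

Lemma GL2_scalar h : GL2 (val_ge w 0) h -> scalar_GL2 w h.
Proof. by move=> Gh; apply/scalar_GL2P; exists 1, h; rewrite oner_eq0 scale1r. Qed.

Lemma scalar_GL2_1 : scalar_GL2 w 1%:M.
Proof. exact/GL2_scalar/GL2_1. Qed.

Lemma scalar_GL2_det h : scalar_GL2 w h -> w (\det h) = 0 ->
  GL2 (val_ge w 0) h.
Proof.
move=> /scalar_GL2P[a [h' [a0 /(GL2_valP hw)[Oh h0 wh'] ->]]].
rewrite detZ valuationM ?expf_neq0 // wh' addr0 expr2 valuationM // => wa.
have {}wa : w a = 0 by lia.
have Oa : val_ge w 0 a by right; rewrite wa.
apply/(GL2_valP hw); rewrite detZ mulf_neq0 ?expf_neq0 //; split=> //.
  by move=> i j; rewrite mxE; apply: subringM.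
by rewrite valuationM ?expf_neq0 // wh' addr0 expr2 valuationM // wa.
Qed.

Lemma scalar_GL2_mul g h : scalar_GL2 w g -> scalar_GL2 w h ->
  scalar_GL2 w (g *m h).
Proof.
move=> /scalar_GL2P[a [g' [a0 Gg' ->]]] /scalar_GL2P[b [h' [b0 Gh' ->]]].
apply/scalar_GL2P; exists (a * b), (g' *m h'); split.
- by rewrite mulf_neq0.
- exact: GL2_mul.
- by rewrite -scalemxAl -scalemxAr scalerA.
Qed.

Lemma scalar_GL2_unit h : scalar_GL2 w h -> h \in unitmx.
Proof.
move=> /scalar_GL2P[a [h' [a0 [h'U _ _] ->]]].
by rewrite unitmxZ // unitfE.
Qed.

Lemma scalar_GL2_inv h : scalar_GL2 w h -> scalar_GL2 w (invmx h).
Proof.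
move=> /scalar_GL2P[a [h' [a0 Gh' ->]]]; apply/scalar_GL2P.
exists a^-1, (invmx h'); split; [by rewrite invr_eq0|exact: GL2_inv|].
case: (Gh') => h'U _ _; rewrite invmxZ //.
by rewrite unitmxZ // unitfE.
Qed.

Lemma det_scalar_GL2 h : scalar_GL2 w h -> exists n : int, w (\det h) = n *+ 2.
Proof.
move=> /scalar_GL2P[a [h' [a0 /(GL2_valP hw)[_ h0 wh'] ->]]]; exists (w a).
by rewrite detZ valuationM ?expf_neq0 // wh' addr0 expr2 valuationM // mulr2n.
Qed.

Lemma coset_vertexP g g' : coset_vertex w g = coset_vertex w g' <->
  exists2 h, scalar_GL2 w h & g = g' *m h.
Proof.
split=> [e|[h Gh ->]].
  have : coset_vertex w g g by exists 1%:M; [apply: scalar_GL2_1 | rewrite mulmx1].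
  by rewrite e => -[h Gh <-]; exists h.
apply/seteqP; split=> [_ [h' Gh' <-]|_ [h' Gh' <-]].
  by rewrite -mulmxA; exists (h *m h') => //; apply: scalar_GL2_mul.
exists (invmx h *m h'); first exact/scalar_GL2_mul/Gh'/scalar_GL2_inv.
by rewrite mulmxA -(mulmxA g') mulmxV ?scalar_GL2_unit // mulmx1.
Qed.

Lemma coset_vertex_mull g m m' : coset_vertex w m = coset_vertex w m' ->
  coset_vertex w (g *m m) = coset_vertex w (g *m m').
Proof.
by move=> /coset_vertexP[h Gh ->]; apply/coset_vertexP; exists h; rewrite ?mulmxA.
Qed.

Lemma coset_vertex_mulr g h : scalar_GL2 w h ->
  coset_vertex w (g *m h) = coset_vertex w g.
Proof. by move=> Gh; apply/coset_vertexP; exists h. Qed.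

Definition elementary m :=
  [/\ forall i j, val_ge w 0 (m i j), \det m != 0 & w (\det m) = 1].

(** The double coset Z GL_2(O) diag(pi, 1) GL_2(O): the vertices of g1 and g2
    are adjacent exactly when it contains g2^-1 g1.  In this form the relation
    is visibly symmetric and independent of the representatives. *)
Definition adjacency m :=
  exists a m', [/\ a != 0, elementary m' & m = a *: m'].

Lemma adjacency_unit m : adjacency m -> m \in unitmx.
Proof.
by move=> [a [m' [a0 [_ m'0 _] ->]]]; rewrite unitmxZ ?unitfE // unitmx_det.
Qed.

Lemma adjacency_mulr m h : adjacency m -> scalar_GL2 w h -> adjacency (m *m h).
Proof.
move=> [a [m' [a0 [Om' m'0 wm'] ->]]] /scalar_GL2P[b [h' [b0 /(GL2_valP hw)[Oh h0 wh] ->]]].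
exists (a * b), (m' *m h'); split; first by rewrite mulf_neq0.
  split; first exact: mulmx_subring.
    by rewrite det_mulmx mulf_neq0.
  by rewrite det_mulmx valuationM // wm' wh.
by rewrite -scalemxAl -scalemxAr scalerA.
Qed.

Lemma adjacency_mull m h : adjacency m -> scalar_GL2 w h -> adjacency (h *m m).
Proof.
move=> [a [m' [a0 [Om' m'0 wm'] ->]]] /scalar_GL2P[b [h' [b0 /(GL2_valP hw)[Oh h0 wh] ->]]].
exists (b * a), (h' *m m'); split; first by rewrite mulf_neq0.
  split; first exact: mulmx_subring.
    by rewrite det_mulmx mulf_neq0.
  by rewrite det_mulmx valuationM // wm' wh.
by rewrite -scalemxAl -scalemxAr scalerA.
Qed.

(** Up to a scalar the inverse is the adjugate, which has the same determinant. *)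
Lemma adjacency_inv m : adjacency m -> adjacency (invmx m).
Proof.
move=> [a [m' [a0 [Om' m'0 wm'] ->]]].
have m'U : m' \in unitmx by rewrite unitmx_det.
exists (a^-1 * (\det m')^-1), (\adj m'); split.
- by rewrite mulf_neq0 ?invr_eq0.
- by split; rewrite ?det_adj2 //; apply: adj_subring.
- rewrite invmxZ ?unitmxZ ?unitfE // -scalerA; congr (_ *: _).
  by rewrite /invmx m'U.
Qed.

Lemma odd_adjacency m : adjacency m -> exists n : int, w (\det m) = n *+ 2 + 1.
Proof.
move=> [a [m' [a0 [Om' m'0 wm'] ->]]]; exists (w a).
by rewrite detZ valuationM ?expf_neq0 // wm' expr2 valuationM // mulr2n.
Qed.

(** The valuation of the determinant is even on Z GL_2(O) and odd on the
    adjacency double coset, so an element whose determinant is a unit never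
    moves a vertex to one of its neighbours. *)
Lemma adjacent_not_equivalent x g h m : \det g != 0 -> \det x != 0 ->
  w (\det x) = 0 -> scalar_GL2 w h -> adjacency m -> x *m g <> g *m m *m h.
Proof.
move=> g0 x0 wx Gh hm /(congr1 determinant); rewrite !det_mulmx.
have h0 : \det h != 0 by rewrite -unitmx_det scalar_GL2_unit.
have m0 : \det m != 0 by rewrite -unitmx_det adjacency_unit.
move=> /(congr1 w); rewrite !valuationM ?mulf_neq0 // wx.
have [n ->] := det_scalar_GL2 Gh; have [l ->] := odd_adjacency hm.
rewrite !mulr2n; move=> e; lia.
Qed.

End Vertices.

(** * The neighbours of a vertex as points of the projective line *)

Section Neighbours.
Variables (k F : fieldType) (f : {rmorphism k -> F}) (w : F -> int).
Hypothesis hw : discrete_valuation w.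
Hypothesis f_val : forall c, val_ge w 0 (f c).
Hypothesis f_res : forall y, val_ge w 0 y -> exists c, val_ge w 1 (y - f c).
Let hO := subring_val_ge hw.
Implicit Types (h m : 'M[F]_2) (b : 'M[k]_2).

Lemma val_const c : c != 0 -> w (f c) = 0.
Proof.
move=> c0; have fc0 : f c != 0 by rewrite fmorph_eq0.
have : val_ge w 0 (f c)^-1 by rewrite -fmorphV.
case: (f_val c) => [/eqP|H1]; first by rewrite (negPf fc0).
case=> [/eqP|]; first by rewrite invr_eq0 (negPf fc0).
by rewrite valuationV //; lia.
Qed.

Lemma val_ge1_const c : val_ge w 1 (f c) -> c = 0.
Proof.
move=> [/eqP|fc]; first by rewrite fmorph_eq0 => /eqP.
by have [//|/val_const fc0] := eqVneq c 0; rewrite fc0 in fc.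
Qed.

Variables pi : F.
Hypotheses (pi0 : pi != 0) (wpi : w pi = 1).

Lemma val_ge1_div x : val_ge w 1 x -> val_ge w 0 (x / pi).
Proof.
have -> : (0 : int) = 1 + - 1 by lia.
by move=> x1; apply: val_geM => //; right; rewrite valuationV // wpi.
Qed.

Lemma val_ge1_pi : val_ge w 1 pi. Proof. by right; rewrite wpi. Qed.

(** Modulo pi the columns of this matrix span the line t. *)
Definition neighbour (t : option k) : 'M[F]_2 :=
  if t is Some z then mat2 pi (f z) 0 1 else mat2 1 0 0 pi.

Lemma det_neighbour t : \det (neighbour t) = pi.
Proof.
rewrite det2; case: t => [z|]; rewrite /neighbour !mxE /=.
  by rewrite mulr1 mulr0 subr0.
by rewrite mul1r mulr0 subr0.
Qed.

Lemma elementary_mat2 z : val_ge w 0 z -> elementary w (mat2 pi z 0 1).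
Proof.
move=> Oz; rewrite /elementary det2 !mxE /= mulr1 mulr0 subr0; split=> //.
have O1 := subring1 hO; have O0 := val_ge0 w 0.
have Opi : val_ge w 0 pi by right; rewrite wpi.
by apply: ord2P; apply: ord2P; rewrite mxE /=.
Qed.

Lemma elementary_neighbour t : elementary w (neighbour t).
Proof.
case: t => [z|]; first exact: elementary_mat2.
have := det_neighbour None; rewrite /elementary => ->; split=> //.
have O1 := subring1 hO; have O0 := val_ge0 w 0.
have Opi : val_ge w 0 pi by right; rewrite wpi.
by apply: ord2P; apply: ord2P; rewrite mxE /=.
Qed.

Lemma adjacency_neighbour t : adjacency w (neighbour t).
Proof.
exists 1, (neighbour t); rewrite oner_eq0 scale1r.
by split=> //; apply: elementary_neighbour.
Qed.

(** Every column of m lies, modulo pi, on the line s. *)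
Definition fits m (s : option k) := forall j,
  val_ge w 1 (f (line_x s) * m 1 j - f (line_y s) * m 0 j).

(** The vertex of an elementary matrix is determined by the line spanned by its
    columns modulo pi: that line is preserved by column operations, and when it
    is s, the matrix (neighbour s)^-1 m is integral with unit determinant. *)
Lemma fitsP m s : elementary w m ->
  coset_vertex w m = coset_vertex w (neighbour s) <-> fits m s.
Proof.
move=> [Om m0 wm]; split.
  move=> /(coset_vertexP hw)[_ /(scalar_GL2P w)[a [h [a0 /(GL2_valP hw)[Oh h0 wh] ->]]]].
  rewrite -scalemxAr => em.
  have wa : w a = 0.
    have := congr1 (fun x => w (\det x)) em.
    rewrite detZ det_mulmx det_neighbour valuationM ?expf_neq0 ?mulf_neq0 //.
    by rewrite [w (pi * _)]valuationM // wm wh wpi expr2 valuationM //; lia.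
  have Oa : val_ge w 0 a by right; rewrite wa.
  have Oah i j : val_ge w 0 (a * h i j) by apply: subringM.
  move=> j.
  have mE i : m i j = a * (neighbour s i 0 * h 0 j + neighbour s i 1 * h 1 j).
    by rewrite em mxE mulmx2E.
  rewrite !{}mE.
  case: s em => [z|] _; rewrite /neighbour !mxE /= rmorph1 ?rmorph0.
    set x := (X in val_ge w 1 X); have -> : x = - (a * h 0 j) * pi by rewrite /x; ring.
    by apply: max_val_geM val_ge1_pi => //; apply: subringN.
  set x := (X in val_ge w 1 X); have -> : x = a * h 1 j * pi by rewrite /x; ring.
  by apply: max_val_geM val_ge1_pi.
move=> fit; apply/(coset_vertexP hw).
(* This is (neighbour s)^-1 m, computed entry by entry. *)
pose h : 'M[F]_2 := if s is Some z
  then \matrix_(i, j) (if i == 0 then (m 0 j - f z * m 1 j) / pi else m 1 j)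
  else \matrix_(i, j) (if i == 0 then m 0 j else m 1 j / pi).
have em : m = neighbour s *m h.
  apply/matrixP => i j; rewrite mulmx2E.
  move: i; case: s @h fit => [z|] h fit; apply: ord2P; rewrite !mxE /=; by field.
exists h => //; apply/GL2_scalar/(GL2_valP hw).
have e := det_mulmx (neighbour s) h; rewrite -em det_neighbour in e.
have h0 : \det h != 0 by apply: contraNneq m0 => h0; rewrite e h0 mulr0.
split=> //; last first.
  by apply: (addrI 1); rewrite -[in LHS]wpi -(valuationM hw pi0 h0) -e wm addr0.
move=> i j; have := fit j; have O1 := Om 1 j; have O0 := Om 0 j.
move: i; case: s @h {fit em e h0} => [z|] h /=; apply: ord2P; rewrite !mxE /= //.
  rewrite rmorph1 mul1r => /val_geN - /(_ hw) /val_ge1_div.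
  by rewrite opprB.
by rewrite rmorph1 rmorph0 mul1r mul0r subr0 => /val_ge1_div.
Qed.

Definition reduces_to m b := forall i j, val_ge w 1 (m i j - f (b i j)).

Lemma exists_reduction m : (forall i j, val_ge w 0 (m i j)) ->
  exists b, reduces_to m b.
Proof.
move=> Om; have c i j : {c | val_ge w 1 (m i j - f c)} by apply/cid/f_res.
by exists (\matrix_(i, j) sval (c i j)) => i j; rewrite mxE; case: (c i j).
Qed.

Lemma val_ge1_congr x y : val_ge w 1 (x - y) -> val_ge w 1 x <-> val_ge w 1 y.
Proof.
move=> xy; split=> H; last by rewrite -(subrK y x); apply: val_geD.
by rewrite -(subKr x y); apply: val_geB.
Qed.

Lemma congrM x y x' y' : val_ge w 0 x -> val_ge w 0 y' ->
  val_ge w 1 (x - x') -> val_ge w 1 (y - y') -> val_ge w 1 (x * y - x' * y').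
Proof.
move=> Ox Oy' xx yy; have -> : x * y - x' * y' = x * (y - y') + y' * (x - x') by ring.
by apply: val_geD => //; apply: max_val_geM.
Qed.

Lemma reduces_to_det m b : (forall i j, val_ge w 0 (m i j)) -> reduces_to m b ->
  val_ge w 1 (\det m - f (\det b)).
Proof.
move=> Om mb; rewrite !det2 rmorphB !rmorphM.
set X := (X in val_ge w 1 X).
have -> : X = (m 0 0 * m 1 1 - f (b 0 0) * f (b 1 1))
              - (m 0 1 * m 1 0 - f (b 0 1) * f (b 1 0)) by rewrite /X; ring.
by apply: val_geB => //; apply: congrM.
Qed.

(** After scaling m is elementary; its reduction is singular, so its two columns
    lie on a common line. *)
Lemma adjacency_neighbourP m : adjacency w m ->
  exists t, coset_vertex w m = coset_vertex w (neighbour t).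
Proof.
move=> [a [m' [a0 em' ->]]].
have eqv : coset_vertex w (a *: m') = coset_vertex w m'.
  rewrite -mul_mx_scalar; apply: coset_vertex_mulr => //.
  apply/scalar_GL2P; exists a, 1%:M; split=> //; first exact: GL2_1.
  by rewrite scale_scalar_mx mulr1.
rewrite {}eqv; case: (em') => Om m0 wm.
have [b mb] := exists_reduction Om.
have b0 : \det b = 0.
  apply: val_ge1_const; apply/(val_ge1_congr (reduces_to_det Om mb)).
  by right; rewrite wm.
suff [s bs] : exists s, forall j, line_x s * b 1 j = line_y s * b 0 j.
  exists s; apply/fitsP => // j.
  have -> : f (line_x s) * m' 1 j - f (line_y s) * m' 0 j =
      f (line_x s) * (m' 1 j - f (b 1 j)) - f (line_y s) * (m' 0 j - f (b 0 j)).
    rewrite !mulrBr -!rmorphM bs; ring.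
  by apply: val_geB => //; apply: max_val_geM.
move: b0; rewrite det2 => /eqP; rewrite subr_eq0 => /eqP b0.
have [b10|b10] := eqVneq (b 1 0) 0; last first.
  exists (Some (b 0 0 / b 1 0)); apply: ord2P; rewrite /= mul1r ?divfK //.
  by rewrite mulrAC b0 mulfK.
have [b11|b11] := eqVneq (b 1 1) 0; last first.
  exists (Some (b 0 1 / b 1 1)); apply: ord2P; rewrite /= mul1r ?divfK //.
  by rewrite mulrAC -b0 mulfK.
by exists None; apply: ord2P; rewrite /= mul1r mul0r.
Qed.

(** The action of GL_2(O) on the neighbours of the standard vertex is the action
    of its reduction on the projective line. *)
Lemma neighbour_moved h b t s : GL2 (val_ge w 0) h -> reduces_to h b ->
  coset_vertex w (h *m neighbour t) = coset_vertex w (neighbour s) <->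
  sends_form b t s = 0.
Proof.
move=> /(GL2_valP hw)[Oh h0 wh] hb.
have [On n0 wn] := elementary_neighbour t.
have em : elementary w (h *m neighbour t).
  split; first exact: mulmx_subring.
    by rewrite det_mulmx mulf_neq0.
  by rewrite det_mulmx valuationM // wh wn.
(* The column of neighbour t that is not divisible by pi spans the line t. *)
pose l : 'I_2 := if t is Some _ then 1 else 0.
pose y := f (line_x s) * (h *m neighbour t) 1 l - f (line_y s) * (h *m neighbour t) 0 l.
have hl i : (h *m neighbour t) i l = h i 0 * f (line_x t) + h i 1 * f (line_y t).
  rewrite mulmx2E /l; case: t {On n0 wn em l y} => [z|] /=; rewrite !mxE /=.
    by rewrite rmorph1.
  by rewrite rmorph1 rmorph0.
have yP : val_ge w 1 (y - f (sends_form b t s)).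
  rewrite /y !hl /sends_form rmorphB !rmorphM !rmorphD !rmorphM.
  set X := (X in val_ge w 1 X).
  have -> : X =
    f (line_x s) * (f (line_x t) * (h 1 0 - f (b 1 0)) + f (line_y t) * (h 1 1 - f (b 1 1)))
    - f (line_y s) * (f (line_x t) * (h 0 0 - f (b 0 0)) + f (line_y t) * (h 0 1 - f (b 0 1))).
    by rewrite /X; ring.
  by apply: val_geB => //; apply: max_val_geM => //; apply: val_geD => //;
    apply: max_val_geM.
split.
  move=> /(fitsP _ em)/(_ l) fit.
  by apply: val_ge1_const; apply/(val_ge1_congr yP).
move=> bts; apply/(fitsP _ em) => j.
have [->|jl] := eqVneq j l.
  by apply/(val_ge1_congr yP); rewrite bts rmorph0; left.
have hj i : val_ge w 1 ((h *m neighbour t) i j).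
  rewrite mulmx2E; move: jl; move: j; rewrite /l.
  case: t {On n0 wn em l y hl yP bts} => [z|]; apply: ord2P => // _; rewrite !mxE /=.
    by rewrite mulr0 addr0; apply: max_val_geM val_ge1_pi.
  by rewrite mulr0 add0r; apply: max_val_geM val_ge1_pi.
by apply: val_geB => //; apply: max_val_geM.
Qed.

End Neighbours.

(** * Edges at a vertex, and the action on edges *)

Section Edges.
Variables (k F : fieldType) (f : {rmorphism k -> F}) (w : F -> int).
Hypothesis hw : discrete_valuation w.
Hypothesis f_val : forall c, val_ge w 0 (f c).
Hypothesis f_res : forall y, val_ge w 0 y -> exists c, val_ge w 1 (y - f c).
Variables (pi : F).
Hypotheses (pi0 : pi != 0) (wpi : w pi = 1).
Variable R : set F.
Hypothesis hR : residue_representatives w R.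
Implicit Types g m x : 'M[F]_2.

Lemma adjacency_of_adjacent v1 v2 : tree_adjacent w pi R v1 v2 ->
  exists g1 g2, [/\ g1 \in unitmx, g2 \in unitmx, v1 = coset_vertex w g1,
    v2 = coset_vertex w g2 & adjacency w (invmx g2 *m g1)].
Proof.
move=> [g1 [g2 [g1U g2U e1 e2 H]]]; exists g1, g2; split=> //.
suff [m adjm /(coset_vertexP hw)[h Gh ->]] : exists2 m, adjacency w m &
    coset_vertex w (invmx g2 *m g1) = coset_vertex w m.
  exact: adjacency_mulr.
case: H => [[z Rz ->]|->].
  exists (mat2 pi z 0 1) => //; exists 1, (mat2 pi z 0 1).
  rewrite oner_eq0 scale1r; split=> //; apply: elementary_mat2 => //.
  by case: hR => + _; apply.
exists (mat2 pi^-1 0 0 1) => //; exists pi^-1, (neighbour f pi None); split.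
- by rewrite invr_eq0.
- exact: elementary_neighbour.
- by apply: mat2_eq; rewrite !mxE /= ?mulr1 ?mulr0 // mulVf.
Qed.

(** The line t of the normal form is only known through an element of k; the
    representative in R of the same residue class gives the same vertex. *)
Lemma adjacent_of_adjacency g1 g2 : g1 \in unitmx -> g2 \in unitmx ->
  adjacency w (invmx g2 *m g1) ->
  tree_adjacent w pi R (coset_vertex w g1) (coset_vertex w g2).
Proof.
move=> g1U g2U /(adjacency_neighbourP hw f_val f_res pi0 wpi)[t et].
exists g1, g2; split=> //; rewrite {}et; case: t => [z|].
  left; have [_ /(_ (f z) (f_val z))[z' [[Rz' zz'] _]]] := hR.
  exists z' => //; apply/(coset_vertexP hw); exists (mat2 1 ((f z - z') / pi) 0 1).
    apply/GL2_scalar/(GL2_valP hw); rewrite det2 !mxE /= mulr1 mulr0 subr0.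
    rewrite oner_neq0 (valuation1 hw); split=> //.
    have O1 := subring1 (subring_val_ge hw); have O0 := val_ge0 w 0.
    by apply: ord2P; apply: ord2P; rewrite mxE //=; apply: val_ge1_div.
  by apply: mat2_eq; rewrite mulmx2E !mxE /=; field.
right; apply/(coset_vertexP hw); exists (pi *: 1%:M).
  apply/scalar_GL2P; exists pi, 1%:M; split=> //.
  exact/GL2_1/subring_val_ge.
by apply: mat2_eq; rewrite mulmx2E !mxE /=; field.
Qed.

Lemma tree_edge_neighbour g t : g \in unitmx ->
  tree_edges w pi R [set coset_vertex w g; coset_vertex w (g *m neighbour f pi t)].
Proof.
move=> gU; have adjt : adjacency w (neighbour f pi t) by apply: adjacency_neighbour.
exists (coset_vertex w (g *m neighbour f pi t)), (coset_vertex w g).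
split; last exact: setUC.
apply: adjacent_of_adjacency => //; last by rewrite mulKmx.
by rewrite unitmx_mul gU; apply: adjacency_unit adjt.
Qed.

(** Either end of the edge may be the vertex of g; the symmetry of the adjacency
    double coset reduces both cases to one normal form. *)
Lemma tree_edge_atP g e : g \in unitmx -> tree_edges w pi R e ->
  e (coset_vertex w g) ->
  exists t, e = [set coset_vertex w g; coset_vertex w (g *m neighbour f pi t)].
Proof.
move=> gU [v1 [v2 [/adjacency_of_adjacent[g1 [g2 [g1U g2U -> -> adj12]]] ->]]].
have normal h m : scalar_GL2 w h -> adjacency w m ->
    exists t, coset_vertex w (g *m h *m m) = coset_vertex w (g *m neighbour f pi t).
  move=> Gh adjm.
  have [t et] := adjacency_neighbourP hw f_val f_res pi0 wpi (adjacency_mull hw adjm Gh).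
  by exists t; rewrite -mulmxA; apply: coset_vertex_mull.
case=> eg; have /(coset_vertexP hw)[h Gh e'] := esym eg; rewrite -{}eg.
- have e2 : g1 *m invmx (invmx g2 *m g1) = g2.
    rewrite -[X in X *m _](mulKVmx g2U g1) -mulmxA mulmxV ?mulmx1 //.
    exact: adjacency_unit adj12.
  have [t et] := normal _ _ Gh (adjacency_inv hw adj12).
  by exists t; rewrite -et -e' e2.
- have [t et] := normal _ _ Gh adj12.
  by exists t; rewrite -et -e' mulKVmx // setUC.
Qed.

End Edges.

Section Action.
Variables (K F : fieldType) (j : {rmorphism K -> F}) (w : F -> int).

Lemma left_mul_coset x (g : 'M[F]_2) :
  left_mul j x (coset_vertex w g) = coset_vertex w (map_mx j x *m g).
Proof.
rewrite /left_mul /coset_vertex image_comp; apply: eq_imagel => h _ /=.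
by rewrite mulmxA.
Qed.

Lemma left_mulM x y v : left_mul j (x *m y) v = left_mul j x (left_mul j y v).
Proof.
rewrite /left_mul image_comp; apply: eq_imagel => h _ /=.
by rewrite map_mxM mulmxA.
Qed.

Lemma left_mul1 v : left_mul j 1%:M v = v.
Proof.
rewrite /left_mul map_mx1 -[RHS]image_id; apply: eq_imagel => h _ /=.
by rewrite mul1mx.
Qed.

Variables (C : set K) (hC : subring C).

Lemma mem_edge_orbit e : edge_orbit (GL2 C) (left_mul j) e e.
Proof.
exists 1%:M; first exact: GL2_1.
by rewrite -[RHS]image_id; apply: eq_imagel => v _; rewrite left_mul1.
Qed.

Lemma edge_orbit_moved x e : GL2 C x ->
  edge_orbit (GL2 C) (left_mul j) (left_mul j x @` e) =
  edge_orbit (GL2 C) (left_mul j) e.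
Proof.
move=> Gx; have xU : x \in unitmx by case: Gx.
apply/seteqP; split=> _ [y Gy <-].
  exists (y *m x); first exact: GL2_mul.
  by rewrite image_comp; apply: eq_imagel => v _; rewrite /= left_mulM.
exists (y *m invmx x); first exact/GL2_mul/GL2_inv.
rewrite image_comp; apply: eq_imagel => v _ /=.
by rewrite -left_mulM -mulmxA mulVmx ?mulmx1.
Qed.

Lemma tree_edges_moved pi R x e : x \in unitmx -> tree_edges w pi R e ->
  tree_edges w pi R (left_mul j x @` e).
Proof.
move=> xU [v1 [v2 [[g1 [g2 [g1U g2U -> -> H]]] ->]]].
have XU : map_mx j x \in unitmx by rewrite map_unitmx.
rewrite image_setU !image_set1 !left_mul_coset.
exists (coset_vertex w (map_mx j x *m g1)), (coset_vertex w (map_mx j x *m g2)).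
split=> //; exists (map_mx j x *m g1), (map_mx j x *m g2).
rewrite !unitmx_mul XU; split=> //.
suff -> : invmx (map_mx j x *m g2) *m (map_mx j x *m g1) = invmx g2 *m g1 by [].
by rewrite -{1}(mulKVmx g2U g1) (mulmxA _ g2) mulKmx // unitmx_mul XU.
Qed.

End Action.

(** * The completion at a place of degree one *)

Section Completion.
Variables (k K : fieldType) (iota : {rmorphism k -> K}) (Oinf : set K).
Hypothesis hinf : place iota Oinf.
Variables (Kinf : fieldType) (j : {rmorphism K -> Kinf}) (w : Kinf -> int).
Hypothesis hKinf : is_completion Oinf j w.

Lemma completion_valuation : discrete_valuation w.
Proof. by case: hKinf. Qed.

Let hw := completion_valuation.

Lemma max_ideal_val x : max_ideal Oinf x <-> val_ge w 1 (j x).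
Proof.
have [_ hO _ _] := hKinf; rewrite /max_ideal /= !hO fmorphV.
have [->|x0] := eqVneq x 0.
  by rewrite rmorph0; split=> _; [left | split; [left | left]].
have jx0 : j x != 0 by rewrite fmorph_eq0.
have Nx : x <> 0 by apply/eqP.
by rewrite (val_ge1P hw jx0); split=> -[Ox H]; split=> //; [case: H | right].
Qed.

(** By density some x in K has valuation 1; it lies in the maximal ideal, so p
    divides it and cannot have a larger valuation. *)
Lemma local_parameter_val p : local_parameter Oinf p -> w (j p) = 1 /\ j p != 0.
Proof.
move=> hp; have [_ _ [y [y0 wy]]] := hw; have [_ hO dense _] := hKinf.
have [x yx] := dense y 2; have [jx0 wx] := valuation_approx hw y0 wy yx.
have : max_ideal Oinf x by apply/max_ideal_val; right; rewrite wx.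
have : max_ideal Oinf p.
  rewrite hp; exists 1; last by rewrite mulr1.
  exact: subring1 (subring_place hinf).
move=> /max_ideal_val pw; rewrite hp => -[z Oz pz].
have p0 : j p != 0.
  by apply: contraNneq jx0 => p0; rewrite -pz rmorphM p0 mul0r.
split=> //; case: pw => [/eqP|pw]; first by rewrite (negPf p0).
have z0 : j z != 0 by apply: contraNneq jx0 => z0; rewrite -pz rmorphM z0 mulr0.
have : val_ge w 0 (j z) by apply/hO.
case=> [/eqP|zw]; first by rewrite (negPf z0).
apply/eqP; rewrite eq_le pw andbT -wx -pz rmorphM valuationM //.
by rewrite lerDl.
Qed.

Lemma constant_val c : val_ge w 0 (j (iota c)).
Proof. by have [_ hO _ _] := hKinf; apply/hO; case: hinf. Qed.

(** The single basis element of the residue field is congruent to a nonzero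
    constant, because 1 is a multiple of it; so constants represent every
    residue class. *)
Lemma residue_constant : place_degree iota Oinf 1 ->
  forall y, val_ge w 0 y -> exists c, val_ge w 1 (y - j (iota c)).
Proof.
have [_ hO dense _] := hKinf.
move=> [b [Ob span]] y Oy; have [x yx] := dense y 1.
have Ox : Oinf x.
  apply/hO; rewrite -(subKr y (j x)); apply: val_geB => //.
  exact: val_geW yx.
have coef z : Oinf z -> exists c, val_ge w 1 (j z - j (iota c) * j (b 0)).
  move=> /span[c [+ _]]; rewrite big_ord1 => /max_ideal_val.
  by rewrite rmorphB rmorphM; exists (c 0).
have [c1] := coef _ (subring1 (subring_place hinf)); rewrite rmorph1 => c1P.
have [c xc] := coef _ Ox.
have c10 : c1 != 0.
  apply: contraPneq c1P => ->; rewrite !rmorph0 mul0r subr0 => -[/eqP|].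
    by rewrite oner_eq0.
  by rewrite (valuation1 hw).
have jc10 : j (iota c1) != 0 by rewrite !fmorph_eq0.
exists (c / c1).
have -> : y - j (iota (c / c1)) = (y - j x) + (j x - j (iota c) * j (b 0))
   - j (iota (c / c1)) * (1 - j (iota c1) * j (b 0)).
  rewrite !fmorph_div; move: jc10; move: (j (iota c1)) (j (iota c)) => d1 d d10.
  by field.
apply: val_geB => //; first exact: val_geD.
by apply: max_val_geM => //; apply: constant_val.
Qed.

End Completion.

(** * The valency *)

Theorem theoremB
  (k K : fieldType) (iota : {rmorphism k -> K})
  (hK : function_field iota) (hk : algebraically_closed_in iota)
  (Oinf : set K) (hinf : place iota Oinf)
  (Kinf : fieldType) (j : {rmorphism K -> Kinf}) (w : Kinf -> int)
  (hKinf : is_completion Oinf j w)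
  (p : K) (hp : local_parameter Oinf p)
  (R : set Kinf) (hR : residue_representatives w R)
  (hdelta : place_degree iota Oinf 1%N)
  (v : set 'M[Kinf]_2) (hv : tree_vertices w v) :
  let G := GL2 (integral_outside iota Oinf) in
  let vt := vertex_orbit G (left_mul j) v in
  let star := edges_at G (left_mul j) (tree_edges w (j p) R) vt in
  [\/ star #= `I_1, star #= `I_2, star #= `I_3 | star #= [set: option k]].
Proof.
move=> G vt star; case: hv => g gU ev.
pose f : {rmorphism k -> Kinf} := j \o iota.
have hw := completion_valuation hKinf; have [_ hO _ _] := hKinf.
have hOw := subring_val_ge hw.
have f_val : forall c, val_ge w 0 (f c) := constant_val hinf hKinf.
have f_res : forall y, val_ge w 0 y -> exists c, val_ge w 1 (y - f c) :=
  residue_constant hinf hKinf hdelta.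
have [wpi pi0] := local_parameter_val hinf hKinf hp.
have hC := subring_integral_outside iota Oinf.
pose u t := coset_vertex w (g *m neighbour f (j p) t).
pose e t := [set v; u t].
pose loc (x : 'M[K]_2) := invmx g *m map_mx j x *m g.
have locE x : map_mx j x *m g = g *m loc x by rewrite /loc -mulmxA mulKVmx.
have det_loc x : \det (loc x) = j (\det x).
  have g0 : \det g != 0 by rewrite -unitmx_det.
  by rewrite /loc !det_mulmx det_inv det_map_mx mulrAC mulVf ?mul1r.
have val_det x : G x -> w (j (\det x)) = 0 /\ \det x != 0.
  move=> /(GL2P _ hC)[Cx x0 Cx'].
  have [c xc] := constant_unit hk hinf (det_subring hC Cx) Cx'.
  have c0 : c != 0 by move: x0; rewrite xc fmorph_eq0.
  by split=> //; rewrite xc; exact: (val_const (f := f) hw f_val c0).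
(* The endomorphisms with entries in C of the lattice that g defines, read in
   the basis g and reduced modulo the maximal ideal. *)
pose B : set 'M[k]_2 := [set b : 'M[k]_2 | exists x : 'M[K]_2, [/\
  forall i l, integral_outside iota Oinf (x i l),
  forall i l, val_ge w 0 (loc x i l) & reduces_to f w (loc x) b]].
have B1 : B 1%:M.
  have loc1 : loc 1%:M = 1%:M by rewrite /loc map_mx1 mulmx1 mulVmx.
  exists 1%:M; rewrite loc1; split.
  - by case: (GL2_1 hC).
  - by case: (GL2_1 hOw).
  - by move=> i l; rewrite !mxE rmorph_nat subrr; left.
have Blin a c b b' : B b -> B b' -> B (a *: b + c *: b').
  move=> [x [Cx Ox xb]] [x' [Cx' Ox' xb']].
  have locD : loc (iota a *: x + iota c *: x') = f a *: loc x + f c *: loc x'.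
    by rewrite /loc map_mxD !map_mxZ mulmxDr mulmxDl -!scalemxAr -!scalemxAl.
  exists (iota a *: x + iota c *: x'); rewrite locD; split=> i l.
  - rewrite lin_mxE; apply: (subringD hC); apply: (subringM hC) => //;
      exact: integral_outside_constant.
  - by rewrite lin_mxE; apply: (subringD hOw); apply: (subringM hOw).
  - rewrite !lin_mxE rmorphD !rmorphM opprD addrACA -!mulrBr.
    by apply: val_geD => //; apply: max_val_geM.
pose q t := edge_orbit G (left_mul j) (e t).
(* In particular no element of G inverts an edge. *)
have not_equiv x t : G x -> left_mul j x v <> u t.
  move=> Gx; rewrite ev left_mul_coset => /(coset_vertexP hw)[h Gh].
  have [wx x0] := val_det _ Gx; have g0 : \det g != 0 by rewrite -unitmx_det.
  apply: (adjacent_not_equivalent hw) => //.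
  - by rewrite det_map_mx fmorph_eq0.
  - by rewrite det_map_mx.
  - exact: adjacency_neighbour.
have moved x t : left_mul j x @` e t = [set left_mul j x v; left_mul j x (u t)].
  by rewrite /e image_setU !image_set1.
have qP t s : q t = q s <-> linked B t s.
  split.
    move=> qts; have : q t (e s) by rewrite qts; apply: mem_edge_orbit.
    case=> x Gx; rewrite moved => ex.
    have xv : left_mul j x v = v.
      have : e s (left_mul j x v) by rewrite -ex; left.
      by case=> // /(not_equiv _ _ Gx).
    have xu : left_mul j x (u t) = u s.
      have : [set left_mul j x v; left_mul j x (u t)] (u s) by rewrite ex; right.
      by case=> // /esym /(not_equiv _ _ Gx).
    have [wx x0] := val_det _ Gx.
    have Gh : GL2 (val_ge w 0) (loc x).
      apply: (scalar_GL2_det hw); last by rewrite det_loc.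
      move: xv; rewrite ev left_mul_coset locE => /(coset_vertexP hw)[h Gh].
      by move=> /(can_inj (mulKmx gU)) ->.
    have [Oh h0 wh] := (GL2_valP hw _).1 Gh.
    have [b hb] := exists_reduction f_res Oh.
    exists b; split.
    + by exists x; split=> //; case: (Gx).
    + apply/eqP => b0; have := reduces_to_det hw f_val Oh hb.
      rewrite b0 rmorph0 subr0 => -[/eqP|]; first by rewrite (negPf h0).
      by rewrite wh.
    + apply/(neighbour_moved hw f_val pi0 wpi t s Gh hb).
      move: xu; rewrite /u left_mul_coset mulmxA locE -mulmxA.
      by move=> /(coset_vertex_mull hw (invmx g)); rewrite !mulKmx.
  move=> [b [[x [Cx Oh hb]] b0 bts]].
  (* The lift x of b is an integral matrix whose determinant has no pole at all:
     it is a constant, congruent to det b, so x is invertible over C. *)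
  have Cdet := det_subring hC Cx.
  have Odet : Oinf (\det x) by apply/hO; rewrite -det_loc; apply: det_subring.
  have [c xc] := constant_of_integral hk Cdet Odet.
  have cb : c = \det b.
    apply/eqP; rewrite -subr_eq0; apply/eqP; apply: (val_ge1_const hw f_val).
    have := reduces_to_det hw f_val Oh hb; rewrite det_loc xc.
    by rewrite rmorphB.
  have c0 : c != 0 by rewrite cb.
  have Gx : G x.
    apply/(GL2P _ hC); split=> //; rewrite xc ?fmorph_eq0 //.
    by rewrite -fmorphV; apply: integral_outside_constant.
  have Gh : GL2 (val_ge w 0) (loc x).
    apply/(GL2_valP hw); rewrite det_loc fmorph_eq0.
    by have [wx x0] := val_det _ Gx.
  rewrite /q -(edge_orbit_moved j hC _ Gx) moved /e.
  congr (edge_orbit _ _ [set _; _]).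
    by rewrite ev left_mul_coset locE coset_vertex_mulr //; apply: GL2_scalar.
  rewrite /u left_mul_coset mulmxA locE -mulmxA; apply: (coset_vertex_mull hw).
  by apply/(neighbour_moved hw f_val pi0 wpi t s Gh hb).
(* An edge of the quotient attached to vt has a representative that contains v
   itself. *)
suff -> : star = q @` setT by apply: card_linked_classes qP.
apply/seteqP; split=> [_ [[e0 Ee0 <-] [_ [v' [[y Gy <-] yv' vv']]]]|_ [t _ <-]].
  have : vt v by exists 1%:M; [apply: GL2_1 | apply: left_mul1].
  rewrite vv' => -[x Gx xv].
  have Gxy : G (x *m y) by apply: GL2_mul.
  have e1v : (left_mul j (x *m y) @` e0) (coset_vertex w g).
    rewrite -ev -xv; case: yv' => v0 e0v0 <-.
    by exists v0 => //; rewrite left_mulM.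
  have e1E : tree_edges w (j p) R (left_mul j (x *m y) @` e0).
    by apply: tree_edges_moved => //; case: Gxy.
  have [t et] := tree_edge_atP hw f_val f_res pi0 wpi hR gU e1E e1v.
  exists t => //; rewrite /q /e ev -et; exact: edge_orbit_moved.
split.
  exists (e t) => //; rewrite /e ev.
  exact: (tree_edge_neighbour hw f_val f_res pi0 wpi hR).
exists (e t), v; split=> //; last by left.
exact: mem_edge_orbit.
Qed.
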